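(* For any (finite) directed graph $G$ and any integral cycle basis $\mathscr{B}$ of $G$, the number of spanning trees in $G$ is at most $$\prod_{\gamma\in\mathscr{B}}\bigl|\{a\in A(G)\mid\gamma_a\neq 0\}\bigr|,$$ i.e., the product of the lengths of the oriented cycles in $\mathscr{B}$.
   Context: $A(G)$ is the arc set and $V(G)$ the vertex set of $G$; spanning trees are those of the underlying undirected graph. Let $B$ be the incidence matrix of $G$. An oriented cycle is a vector $\gamma\in\{-1,0,1\}^{A(G)}$ with $B\gamma=0$ that is the signed indicator vector of a circuit of the underlying undirected graph (arcs traversed forward get $+1$, backward $-1$). The cycle space is the subgroup of $\mathbb{Z}^{A(G)}$ generated by the oriented cycles; it is free abelian of some rank $\mu$ (with $\mu=|A(G)|-|V(G)|+1$ if $G$ is connected). An integral cycle basis is a $\mu$-tuple of oriented cycles generating the cycle space as a $\mathbb{Z}$-module. *)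

(* Defs.v *)
From mathcomp Require Import all_boot all_order all_algebra.

Set Implicit Arguments.
Unset Strict Implicit.
Unset Printing Implicit Defensive.

Import GRing.Theory.
Local Open Scope ring_scope.

(* Parallel arcs, antiparallel arcs and loops are all allowed. *)
Record digraph := Digraph {
  verts : finType;
  arcs : finType;
  src : arcs -> verts;
  tgt : arcs -> verts
}.

Section Digraph.

Variable G : digraph.

Definition arc_vec := {ffun arcs G -> int}.

(* A loop has a zero column. *)
Definition incidence (v : verts G) (a : arcs G) : int :=
  (tgt a == v)%:R - (src a == v)%:R.

(* (a, true) is the arc a traversed forward, (a, false) backward. *)
Definition dart := (arcs G * bool)%type.
Definition dtail (d : dart) : verts G := if d.2 then src d.1 else tgt d.1.
Definition dhead (d : dart) : verts G := if d.2 then tgt d.1 else src d.1.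

(* The condition on arcs only matters for length 2: it excludes going back and
   forth along one arc, but allows two parallel or antiparallel arcs. A loop is
   a circuit of length 1. *)
Definition circuit (c : seq dart) : bool :=
  [&& c != [::],
      path.cycle (fun d e => dhead d == dtail e) c,
      uniq [seq dtail d | d <- c] &
      uniq [seq d.1 | d <- c]].

Definition circuit_vec (c : seq dart) : arc_vec :=
  [ffun a => ((a, true) \in c)%:R - ((a, false) \in c)%:R].

Definition oriented_cycle (g : arc_vec) : Prop :=
  [/\ forall a, g a \in [:: -1; 0; 1],
      forall v, \sum_a incidence v a * g a = 0 &
      exists2 c, circuit c & g = circuit_vec c].

Definition cycle_space (x : arc_vec) : Prop :=
  exists m (s : m.-tuple arc_vec),
    (forall g, g \in s -> oriented_cycle g) /\ inIntSpan s x.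

Definition adjacent_in (T : {set arcs G}) : rel (verts G) := fun u v =>
  [exists a in T, (src a == u) && (tgt a == v) || (src a == v) && (tgt a == u)].

Definition connected_by (T : {set arcs G}) : bool :=
  [forall u, forall v, connect (adjacent_in T) u v].

(* Circuits repeat no arc, so bounding their length by #|arcs G| loses nothing
   (see acyclicP); it makes the predicate boolean. *)
Definition acyclic (T : {set arcs G}) : bool :=
  [forall n : 'I_#|arcs G|.+1, forall c : n.-tuple dart,
     circuit c ==> ~~ all (fun d => d.1 \in T) c].

Lemma acyclicP (T : {set arcs G}) :
  reflect (forall c, circuit c -> ~ {in c, forall d, d.1 \in T}) (acyclic T).
Proof.
apply: (iffP forallP) => [acT c cc | acT n].
  have sz : (size c < #|arcs G|.+1)%N.
    case/and4P: cc => _ _ _ u; rewrite ltnS -(size_map fst c).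
    by rewrite -(card_uniqP u) max_card.
  have /forallP/(_ (in_tuple c))/implyP/(_ cc) := acT (Ordinal sz).
  by move=> /negP nall inT; apply: nall; apply/allP.
apply/forallP=> c; apply/implyP=> cc; apply/negP=> /allP.
exact: acT cc.
Qed.

Definition spanning_trees : {set {set arcs G}} :=
  [set T | connected_by T && acyclic T].

End Digraph.

Definition free_of_rank (V : zmodType) (S : V -> Prop) (m : nat) : Prop :=
  exists s : m.-tuple V,
    (forall k : 'I_m -> int,
       \sum_i tnth s i *~ k i = 0 -> forall i, k i = 0) /\
    (forall x, S x <-> inIntSpan s x).

Definition integral_cycle_basis (G : digraph) (mu : nat)
    (B : mu.-tuple (arc_vec G)) : Prop :=
  [/\ free_of_rank (@cycle_space G) mu,
      forall g, g \in B -> oriented_cycle g &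
      forall x, cycle_space x <-> inIntSpan B x].

(* Main.v *)
(** Over the complement of a spanning tree the integral basis restricts to a
    square integer matrix with a one-sided inverse, given by the fundamental
    cycles. Some term of the Leibniz expansion of its determinant is therefore
    nonzero: it chooses in the support of each basis cycle an arc, so that the
    chosen arcs are exactly those outside the tree. The tree is determined by
    this choice, and the number of choices is the product of the lengths. *)
Require Import Defs.
From mathcomp Require Import all_boot all_order all_algebra perm.

Set Implicit Arguments.
Unset Strict Implicit.
Unset Printing Implicit Defensive.

Import Order.TTheory GRing.Theory Num.Theory.
Local Open Scope ring_scope.

(** * Square matrices with a left inverse, and integer spans *)

(** Otherwise each Leibniz term of [\det A] has a zero factor, contradicting [\det D * \det A = 1].
    The dimensions are separate variables because their equality is itself proved where the lemma is
    applied. *)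
Lemma left_inv_transversal (R : comNzRingType) m n
    (A : 'M[R]_(m, n)) (D : 'M[R]_(n, m)) :
    m = n -> D *m A = 1%:M ->
  exists2 p : 'I_m -> 'I_n, bijective p & forall i, A i (p i) != 0.
Proof.
move=> eq_mn; case: _ / eq_mn A D => A D DA.
suff /existsP[s /forallP As] : [exists s : 'S_m, [forall i, A i (s i) != 0]].
  by exists s => //; exists (s^-1)%g; [apply: permK | apply: permKV].
apply: contraT; rewrite negb_exists => /forallP noS.
have /eqP := congr1 determinant DA; rewrite det_mulmx det1 [\det A]big1 => [|s _].
  by rewrite mulr0 eq_sym oner_eq0.
have := noS s; rewrite negb_forall => /existsP[i].
by rewrite negbK => /eqP Ai0; rewrite (bigD1 i) //= Ai0 mul0r mulr0.
Qed.

Lemma inIntSpan_tnth (V : zmodType) m (s : m.-tuple V) x :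
  inIntSpan s x -> exists a : 'I_m -> int, x = \sum_i tnth s i *~ a i.
Proof.
by case=> a ->; exists a; apply: eq_bigr => i _; rewrite (tnth_nth 0).
Qed.

(** * Boundaries and circuits *)

Section Cycles.

Variable G : digraph.
Implicit Types (x y : arc_vec G) (T : {set arcs G}) (c : seq (dart G)).

Definition boundary x v : int := \sum_a incidence v a * x a.

Lemma boundary_sum_mulrz (I : finType) (f : I -> arc_vec G) (k : I -> int) v :
  boundary (\sum_i f i *~ k i) v = \sum_i boundary (f i) v * k i.
Proof.
under [RHS]eq_bigr do rewrite mulr_suml.
rewrite exchange_big /=; apply: eq_bigr => a _.
rewrite sum_ffunE mulr_sumr; apply: eq_bigr => i _.
by rewrite ffunMzE -mulrzr intz mulrA.
Qed.

Lemma boundaryB x y v : boundary (x - y) v = boundary x v - boundary y v.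
Proof.
by rewrite -sumrB; apply: eq_bigr => a _; rewrite !ffunE mulrDr mulrN.
Qed.

(** In this form, heads and tails of a closed walk are visibly the same multiset. *)
Lemma cycle_darts c :
  path.cycle (fun d e => dhead d == dtail e) c =
    ([seq dhead d | d <- c] == rot 1 [seq dtail d | d <- c]).
Proof.
case: c => [|d c]; rewrite ?eqxx //= rot1_cons.
(* Only the start of the walk is generalized; the dart that closes it stays fixed. *)
by elim: c {1 3}d => [|e c IH] d0 /=; rewrite eqseq_cons ?IH ?andbT.
Qed.

(** The boundary is a sum over the darts of [c], each counting +1 at its head and -1 at its tail.
    The heads are a rotation of the tails, so everything cancels. *)
Lemma boundary_circuit_vec c v : circuit c -> boundary (circuit_vec c) v = 0.
Proof.
rewrite /circuit cycle_darts => /and4P[_ /eqP rotE _ uc]; have {}uc := map_uniq uc.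
pose F (d : dart G) : int := (dhead d == v)%:R - (dtail d == v)%:R.
transitivity (\sum_(d <- c) F d).
  rewrite big_uniq //= big_mkcond /=.
  pose H a b := if (a, b) \in c then F (a, b) else 0.
  rewrite (eq_bigr (fun d => H d.1 d.2)) => [|[]] //; rewrite -pair_bigA /H /=.
  apply: eq_bigr => a _; rewrite big_bool /= ffunE /incidence /F /dhead /dtail /=.
  rewrite mulrBr -[_ - (tgt a == v)%:R]opprB.
  by do 2!case: ifP => _; rewrite ?mulr1 ?mulr0 ?addr0 ?subr0.
rewrite sumrB -(big_map (@dhead G) xpredT (fun u => (u == v)%:R)).
rewrite -(big_map (@dtail G) xpredT (fun u => (u == v)%:R)) rotE.
by rewrite (perm_big _ (permEl (perm_rot 1 _))) subrr.
Qed.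

Lemma circuit_vec_oriented_cycle c : circuit c -> oriented_cycle (circuit_vec c).
Proof.
move=> cc; split; [|by move=> v; apply: boundary_circuit_vec | by exists c].
by move=> a; rewrite ffunE; do 2!case: (_ \in c).
Qed.

Lemma oriented_cycle_space x : oriented_cycle x -> cycle_space x.
Proof.
move=> ox; exists 1, [tuple x]; split=> [g|]; first by rewrite inE => /eqP ->.
by exists [ffun=> 1]; rewrite big_ord1 ffunE mulr1z.
Qed.

Lemma cycle_space_boundary x : cycle_space x -> forall v, boundary x v = 0.
Proof.
case=> m [s [os /inIntSpan_tnth[a ->]]] v.
rewrite boundary_sum_mulrz big1 // => i _.
by case: (os _ (mem_tnth i s)) => _ + _ => /(_ v) b0; rewrite /boundary b0 mul0r.
Qed.

(** * Fundamental cycles of a spanning tree *)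

(** Arcs do not repeat because a later dart on the first arc would have [u] as an end, while a
    simple path never returns to [u]. *)
Lemma adjacent_path_darts T u p :
    path (adjacent_in T) u p -> uniq (u :: p) ->
  exists ds : seq (dart G),
    [/\ [seq dtail d | d <- ds] = belast u p, [seq dhead d | d <- ds] = p,
        uniq [seq d.1 | d <- ds] & all (fun d => d.1 \in T) ds].
Proof.
elim: p u => [|w p IH] u /=; first by exists [::].
case/andP=> /existsP[a /andP[aT adj]] pp /andP[uwp uw].
have [ds [tds hds uds Tds]] := IH _ pp uw.
have [b tb hb] : exists2 b, dtail (a, b) = u & dhead (a, b) = w.
  by case/orP: adj => /andP[/eqP <- /eqP <-]; [exists true | exists false].
exists ((a, b) :: ds); rewrite /= tb hb tds hds aT; split=> //.
rewrite uds andbT; apply/mapP=> -[[a' b'] d_ds /= eq_a]; subst a'.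
case/negP: uwp.
have u_end : u = dtail (a, b') \/ u = dhead (a, b').
  by rewrite -tb; case: (b); case: (b'); rewrite /dtail /dhead /=; auto.
case: u_end => ->; last by rewrite inE -[X in _ \in X]hds map_f ?orbT.
by apply: mem_belast; rewrite -tds map_f.
Qed.

(** Close [a] by a simple path in [T] from its head back to its tail; [(a, true)] is then the only
    dart off [T]. For a loop the path is empty. *)
Lemma fundamental_cycle T a :
    connected_by T -> a \notin T ->
  exists2 f, oriented_cycle f & forall b, b \notin T -> f b = (b == a)%:R.
Proof.
move=> /forallP/(_ (tgt a))/forallP/(_ (src a))/connectP[p0 pp0 lp0] aT.
move: lp0; case: (shortenP pp0) => p pp up _ lp {p0 pp0}.
have [ds [tds hds uds /allP Tds]] := adjacent_path_darts pp up.
have a_ds : a \notin [seq d.1 | d <- ds].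
  by apply: contra aT => /mapP[d dds ->]; apply: Tds.
exists (circuit_vec ((a, true) :: ds)).
  apply: circuit_vec_oriented_cycle.
  rewrite /circuit cycle_darts /= a_ds uds tds hds rot1_cons !andbT.
  by rewrite -rcons_uniq [dtail _]lp -lastI eqxx.
move=> b bT; rewrite ffunE !inE.
have nds e : ((b, e) \in ds) = false by apply: contraNF bT => /Tds.
by rewrite !nds !orbF !xpair_eqE /= andbT andbF subr0.
Qed.

(** * Vectors with zero boundary and acyclic support *)

(** With [x] read as a flow, these darts follow its direction, one for each arc of the support. *)
Definition positive_dart x (d : dart G) : bool :=
  if d.2 then 0 < x d.1 else x d.1 < 0.

Lemma positive_dart_arc_inj x d e :
  positive_dart x d -> positive_dart x e -> d.1 = e.1 -> d = e.
Proof.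
case: d e => [a b] [a' b'] /= + + eqa; rewrite /positive_dart -{}eqa /=.
by case: b b' => -[] // h /(lt_trans h); rewrite ltxx.
Qed.

(** Flow conservation: if no positive dart left the head of [d], all terms of the boundary there
    would be nonnegative with sum zero, hence zero, but the term of [d.1] is not. *)
Lemma positive_dart_next x d :
    (forall v, boundary x v = 0) -> positive_dart x d ->
  exists2 e, positive_dart x e & dtail e = dhead d.
Proof.
move=> bx0 xd; set v := dhead d.
suff /existsP[e /andP[xe /eqP ev]] : [exists e, positive_dart x e && (dtail e == v)].
  by exists e.
apply: contraT; rewrite negb_exists => /forallP noe.
have tailN e : positive_dart x e -> dtail e != v.
  by move=> xe; have := noe e; rewrite xe.
have ge0 a : 0 <= incidence v a * x a.
  rewrite /incidence; case: (ltrgt0P (x a)) => [xa|xa|->]; last by rewrite mulr0.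
    have /negPf := tailN (a, true) xa; rewrite /dtail /= => ->.
    by rewrite subr0 mulr_ge0 ?ler0n ?ltW.
  have /negPf := tailN (a, false) xa; rewrite /dtail /= => ->.
  by rewrite sub0r mulr_le0 ?oppr_le0 ?ler0n ?ltW.
have /eqP := psumr_eq0P (fun a _ => ge0 a) (bx0 v) (i := d.1) isT.
have := tailN _ xd; rewrite /v {tailN noe ge0 v} /incidence.
move: xd; rewrite /positive_dart /dtail /dhead.
case: d => a [] /= xa /negPf ->; rewrite eqxx ?subr0 ?sub0r mulf_eq0.
  by rewrite oner_eq0 gt_eqF.
by rewrite oppr_eq0 oner_eq0 lt_eqF.
Qed.

(* Following positive darts from head to tail must eventually close up a
   circuit, all of whose arcs lie in the support of the vector. *)
Lemma acyclic_boundary_eq0 T x :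
    acyclic T -> (forall v, boundary x v = 0) -> (forall a, a \notin T -> x a = 0) ->
  x = 0.
Proof.
move=> /acyclicP acT bx0 xT; apply/ffunP=> a0; rewrite [RHS]ffunE.
apply/eqP; apply: contraT => xa0; exfalso.
have [d0 xd0] : exists d, positive_dart x d.
  have [xa|xa|xa] := ltrgt0P (x a0); [by exists (a0, true) | by exists (a0, false) |].
  by rewrite xa eqxx in xa0.
(* The default [d0] is returned only where [S v] fails. *)
pose out v := odflt d0 [pick e | positive_dart x e && (dtail e == v)].
pose S v := [exists e, positive_dart x e && (dtail e == v)].
have outP v : S v -> positive_dart x (out v) /\ dtail (out v) = v.
  rewrite /out => /existsP[e he]; case: pickP => [e' /andP[-> /eqP ->] //|/(_ e)].
  by rewrite he.
pose f v := dhead (out v).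
have Sf v : S v -> S (f v).
  case/outP=> xo _; have [e xe te] := positive_dart_next bx0 xo.
  by apply/existsP; exists e; rewrite xe te eqxx.
have Siter v n : S v -> S (iter n f v) by move=> Sv; elim: n => //= n; apply: Sf.
(* By finiteness the iterates of [f] run into a loop; [v] is the vertex where it is entered, and
   [k.+1] is a positive return time. *)
have [v Sv fv] : exists2 v, S v & exists k, iter k.+1 f v = v.
  have S0 : S (dtail d0) by apply/existsP; exists d0; rewrite xd0 eqxx.
  have /trajectP[i lt_i eq_i] := looping_order f (dtail d0).
  exists (iter i f (dtail d0)); first exact: Siter.
  exists (order f (dtail d0) - i).-1.
  by rewrite prednK ?subn_gt0 // -iterD subnK // ltnW.
have cyc : fcycle f (orbit f v) by apply/(orbitPcycle 3 0).
have So u : u \in orbit f v -> S u by rewrite -fconnect_orbit => /iter_findex <-; apply: Siter.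
have xo u : u \in orbit f v -> positive_dart x (out u) by move/So/outP=> [].
have to u : u \in orbit f v -> dtail (out u) = u by move/So/outP=> [].
apply: (acT [seq out u | u <- orbit f v]); last first.
  move=> _ /mapP[u ou ->]; apply: contraT => /xT x0.
  by have := xo u ou; rewrite /positive_dart x0; case: ifP; rewrite ltxx.
apply/and4P; split.
- by rewrite -size_eq0 size_map size_orbit -lt0n order_gt0.
- rewrite cycle_map; apply: (sub_in_cycle (P := mem (orbit f v))) cyc; last exact/allP.
  by move=> u w _ ow /= /eqP fu; rewrite to // -fu.
- rewrite -map_comp map_inj_in_uniq ?orbit_uniq // => u w ou ow /=.
  by rewrite !to.
- rewrite -map_comp map_inj_in_uniq ?orbit_uniq // => u w ou ow /= eq_a.
  by rewrite -(to u ou) -(to w ow) (positive_dart_arc_inj (xo u ou) (xo w ow) eq_a).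
Qed.

(** * Choosing the arcs outside a tree *)

Lemma spanning_tree_transversal mu (B : mu.-tuple (arc_vec G)) T :
    integral_cycle_basis B -> T \in spanning_trees G ->
  exists s : {ffun 'I_mu -> arcs G},
    (forall i, tnth B i (s i) != 0) /\ ~: [set s i | i : 'I_mu] = T.
Proof.
case=> -[s [s_free s_span]] _ B_span; rewrite inE => /andP[coT acT].
pose n := #|~: T|; pose e (j : 'I_n) : arcs G := enum_val j.
have eT j : e j \notin T by have := enum_valP j; rewrite inE.
have fcyc j : exists f : arc_vec G,
    oriented_cycle f /\ forall b, b \notin T -> f b = (b == e j)%:R.
  by have [f of_ fE] := fundamental_cycle coT (eT j); exists f.
have [F FP] := fin_all_exists fcyc.
have F_cs j : cycle_space (F j) by apply: oriented_cycle_space; case: (FP j).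
have FE j k : F j (e k) = (k == j)%:R.
  by have [_ ->] := FP j; rewrite ?eT // (inj_eq enum_val_inj).
(* The difference of the two sides has zero boundary and vanishes off [T], so it is zero by
   acyclicity. *)
have expand x : cycle_space x -> x = \sum_j F j *~ x (e j).
  move=> cx; apply/eqP; rewrite -subr_eq0; apply/eqP/(acyclic_boundary_eq0 acT).
    move=> v; rewrite boundaryB boundary_sum_mulrz (cycle_space_boundary cx) sub0r.
    rewrite big1 ?oppr0 // => j _; rewrite cycle_space_boundary ?mul0r //.
  move=> a aT; have aTc : a \in ~: T by rewrite inE.
  rewrite -(enum_rankK_in aTc aTc) -/(e _); set k := enum_rank_in _ _.
  rewrite !ffunE sum_ffunE (bigD1 k) //= ffunMzE FE eqxx big1 ?addr0.
    by rewrite intz subrr.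
  by move=> j jk; rewrite ffunMzE FE eq_sym (negPf jk) mul0rz.
have coefs m (t : m.-tuple (arc_vec G)) : (forall x, cycle_space x <-> inIntSpan t x) ->
    exists C : 'M[int]_(n, m), forall j, F j = \sum_i tnth t i *~ C j i.
  move=> tP; have [C CP] := fin_all_exists (fun j => inIntSpan_tnth ((tP _).1 (F_cs j))).
  by exists (\matrix_(j, i) C j i) => j; rewrite CP; apply: eq_bigr => i _; rewrite mxE.
(* [M t] restricts the vectors of [t] to the arcs outside [T]. The restriction of [F] is the
   identity, so writing [F] in terms of [t] gives a left inverse. *)
pose M m (t : m.-tuple (arc_vec G)) : 'M[int]_(m, n) := \matrix_(i, j) tnth t i (e j).
have left_inv m (t : m.-tuple _) (C : 'M_(n, m)) :
    (forall j, F j = \sum_i tnth t i *~ C j i) -> C *m M m t = 1%:M.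
  move=> CP; apply/matrixP=> j k; rewrite !mxE eq_sym -FE CP sum_ffunE.
  by apply: eq_bigr => i _; rewrite mxE ffunMzE -mulrzr intz mulrC.
have [C CP] := coefs _ _ s_span; have [D DP] := coefs _ _ B_span.
have s_cs i : cycle_space (tnth s i).
  apply/s_span; exists [ffun k => (k == i)%:R].
  rewrite (bigD1 i) //= ffunE eqxx mulr1z big1 ?addr0 ?(tnth_nth 0) // => k ki.
  by rewrite ffunE (negPf ki) mulr0z.
(* Expanding [s] in [F] and [F] back in [s] gives the coefficients [M mu s *m C]; freeness of [s]
   makes them the identity. This bounds [mu] by [n], and the left inverse [C] gives the converse. *)
have MC : M mu s *m C = 1%:M.
  apply/matrixP=> i l; apply/eqP; rewrite -subr_eq0; apply/eqP.
  apply: (s_free (fun l => (M mu s *m C) i l - 1%:M i l)) => {l}.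
  under eq_bigr do rewrite mulrzBr.
  rewrite sumrB; apply/eqP; rewrite subr_eq0; apply/eqP.
  transitivity (tnth s i).
    rewrite [RHS]expand //; under [RHS]eq_bigr do rewrite CP mulrz_suml.
    rewrite exchange_big /=; apply: eq_bigr => l _; rewrite mxE mulrz_sumr.
    by apply: eq_bigr => j _; rewrite mxE mulrC mulrzA.
  rewrite (bigD1 i) //= mxE eqxx mulr1z big1 ?addr0 // => l li.
  by rewrite mxE eq_sym (negPf li) mulr0z.
have mu_n : mu = n.
  by apply/eqP; rewrite eqn_leq (mulmx1_min MC) (mulmx1_min (left_inv _ _ _ CP)).
have [p bp Bp] := left_inv_transversal mu_n (left_inv _ _ _ DP).
(* The inverse [q] shows that every arc outside [T] is chosen. *)
have [q pK qK] := bp; exists [ffun i => e (p i)]; split=> [i|].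
  by have := Bp i; rewrite mxE ffunE.
apply/setP=> a; rewrite inE; case aT: (a \in T).
  by apply/imsetP=> -[i _]; rewrite ffunE => aE; have := eT (p i); rewrite -aE aT.
have aTc : a \in ~: T by rewrite inE aT.
apply/negbF/imsetP; exists (q (enum_rank_in aTc a)) => //.
by rewrite ffunE qK /e enum_rankK_in.
Qed.

End Cycles.

Theorem theorem4p29 (G : digraph) (mu : nat) (B : mu.-tuple (arc_vec G))
    (hB : integral_cycle_basis B) :
  (#|spanning_trees G| <= \prod_(g <- B) #|[set a : arcs G | g a != 0%R]|)%N.
Proof.
pose supp (i : 'I_mu) := [set a : arcs G | tnth B i a != 0].
have -> : (\prod_(g <- B) #|[set a : arcs G | g a != 0%R]| =
    #|family (fun i => mem (supp i)) : {pred {ffun 'I_mu -> arcs G}}|)%N.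
  by rewrite big_tuple card_family foldrE big_map big_enum.
(* Each spanning tree is the image under [unchosen] of a choice function in the family, whose size
   is the product of the lengths. *)
pose unchosen (s : {ffun 'I_mu -> arcs G}) := ~: [set s i | i : 'I_mu].
apply: leq_trans (leq_imset_card unchosen _).
apply/subset_leq_card/subsetP=> T /(spanning_tree_transversal hB)[s [sP <-]].
by apply: (imset_f unchosen); apply/familyP=> i; rewrite inE.
Qed.
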